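(* Let $F_1:X_1\to H_1$ be a continuous frame associated to $(a_2,\dots,a_n)$ for $H_1$ with respect to $(X_1,\mu_1)$, and let $F_2:X_2\to H_2$ be a continuous frame associated to $(b_2,\dots,b_n)$ for $H_2$ with respect to $(X_2,\mu_2)$. Suppose $G_1:X_1\to H_1$ is a dual continuous frame associated to $(a_2,\dots,a_n)$ of $F_1$ and $G_2:X_2\to H_2$ is a dual continuous frame associated to $(b_2,\dots,b_n)$ of $F_2$. Then $\mathcal{G}=G_1\otimes G_2:X\to H_1\otimes H_2$ is a dual continuous frame associated to $(a_2\otimes b_2,\dots,a_n\otimes b_n)$ for $H_1\otimes H_2$ with respect to $(X,\mu)$ of $\mathcal{F}=F_1\otimes F_2:X\to H_1\otimes H_2$.
   Context: Let $n\ge 2$. An $n$-inner product on a complex vector space $H$ with $\dim H\ge n$ is a map $(x,y,x_2,\dots,x_n)\mapsto\langle x,y\mid x_2,\dots,x_n\rangle\in\mathbb{C}$ such that: (i) $\langle x_1,x_1\mid x_2,\dots,x_n\rangle\ge 0$, with equality iff $x_1,\dots,x_n$ are linearly dependent; (ii) it is invariant under permutations of $x_2,\dots,x_n$; (iii) $\langle x,y\mid x_2,\dots,x_n\rangle=\overline{\langle y,x\mid x_2,\dots,x_n\rangle}$; (iv), (v) it is linear in $x$. The induced $n$-norm is $\|x_1,x_2,\dots,x_n\|=\langle x_1,x_1\mid x_2,\dots,x_n\rangle^{1/2}$. $H$ is an $n$-Hilbert space if it is complete: every sequence $(x_k)$ with $\|x_l-x_k,e_2,\dots,e_n\|\to0$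 for all $e_2,\dots,e_n\in H$ has some $x\in H$ with $\|x_k-x,e_2,\dots,e_n\|\to 0$ for all $e_2,\dots,e_n\in H$. $H_1,H_2$ are complex $n$-Hilbert spaces with $n$-inner products $\langle\cdot,\cdot\mid\cdot,\dots,\cdot\rangle_1$, $\langle\cdot,\cdot\mid\cdot,\dots,\cdot\rangle_2$ and induced $n$-norms $\|\cdot,\dots,\cdot\|_1$, $\|\cdot,\dots,\cdot\|_2$; $a_2,\dots,a_n\in H_1$ are linearly independent, and $b_2,\dots,b_n\in H_2$ are linearly independent. $H_F$ is the Hilbert space completion of $H_1/\operatorname{span}\{a_2,\dots,a_n\}$ under the inner product induced by $\langle x,y\rangle_F=\langle x,y\mid a_2,\dots,a_n\rangle_1$, and $H_G$ is the completion of $H_2/\operatorname{span}\{b_2,\dots,b_n\}$ under that induced by $\langle x,y\rangle_G=\langle x,y\mid b_2,\dots,b_n\rangle_2$ (the subscripts $F,G$ refer to the sets $\{a_i\}$, $\{b_i\}$). Elements of $H_1$, $H_2$ are identified with their images in $H_F$, $H_G$, and elementary tensors of $H_1\otimes H_2$ with their images in the Hilbert space tensor product $H_F\otimes H_G$. For elementary tensors, $\langle f\otimes g,f_1\otimes g_1\mid a_2\otimes b_2,\dots,a_n\otimes b_n\rangle=\langle f,f_1\mid a_2,\dots,a_n\rangle_1\langle g,g_1\mid b_2,\dots,b_n\rangle_2$ and $\|f\otimes g,a_2\otimes b_2,\dots,a_n\otimes b_n\|=\|f,a_2,\dots,a_n\|_1\|g,b_2,\dots,b_n\|_2$. $(X,\mu)=(X_1\times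 X_2,\mu_1\otimes\mu_2)$ is the product of measure spaces with $\sigma$-finite positive measures, and $(F_1\otimes F_2)(x_1,x_2)=F_1(x_1)\otimes F_2(x_2)$. $F_1:X_1\to H_1$ is a continuous frame associated to $(a_2,\dots,a_n)$ for $H_1$ if for every $f\in H_1$ the function $x_1\mapsto\langle f,F_1(x_1)\mid a_2,\dots,a_n\rangle_1$ is measurable and there are $0<A\le B<\infty$ with $A\|f,a_2,\dots,a_n\|_1^2\le\int_{X_1}|\langle f,F_1(x_1)\mid a_2,\dots,a_n\rangle_1|^2d\mu_1(x_1)\le B\|f,a_2,\dots,a_n\|_1^2$ for all $f\in H_1$; similarly for $F_2$ with $(b_2,\dots,b_n)$, $H_2$, $(X_2,\mu_2)$. A mapping $\mathcal{F}=F_1\otimes F_2$ is a continuous frame associated to $(a_2\otimes b_2,\dots,a_n\otimes b_n)$ for $H_1\otimes H_2$ if for all $f\in H_1$, $g\in H_2$ the function $x\mapsto\langle f\otimes g,\mathcal{F}(x)\mid a_2\otimes b_2,\dots,a_n\otimes b_n\rangle$ is measurable and there are constants $A,B>0$ with $A\|f\otimes g,a_2\otimes b_2,\dots,a_n\otimes b_n\|^2\le\int_X|\langle f\otimes g,\mathcal{F}(x)\mid a_2\otimes b_2,\dots,a_n\otimes b_n\rangle|^2d\mu(x)\le B\|f\otimes g,a_2\otimes b_2,\dots,a_n\otimes b_n\|^2$ for all $f\in H_1$, $g\in H_2$. Duals: $G_1$ is a dual continuous frame associated to $(a_2,\dots,a_n)$ of the continuous frame $F_1$ if $G_1$ is a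 continuous frame associated to $(a_2,\dots,a_n)$ and $\langle f,g\mid a_2,\dots,a_n\rangle_1=\int_{X_1}\langle f,F_1(x_1)\mid a_2,\dots,a_n\rangle_1\langle G_1(x_1),g\mid a_2,\dots,a_n\rangle_1d\mu_1(x_1)$ for all $f,g\in H_1$; similarly $G_2$ is a dual of $F_2$ if the same holds with $(b_2,\dots,b_n)$, $H_2$, $(X_2,\mu_2)$. $\mathcal{G}$ is a dual continuous frame associated to $(a_2\otimes b_2,\dots,a_n\otimes b_n)$ of $\mathcal{F}$ if both are continuous frames associated to $(a_2\otimes b_2,\dots,a_n\otimes b_n)$ and $$f\otimes g=\int_X\langle f\otimes g,\mathcal{F}(x)\mid a_2\otimes b_2,\dots,a_n\otimes b_n\rangle\,\mathcal{G}(x)\,d\mu(x)\quad\text{for all } f\in H_1,\ g\in H_2,$$ as an identity in $H_F\otimes H_G$ with the integral in the weak sense. *)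

(* Defs.v *)
From HB Require Import structures.
From mathcomp Require Import all_boot all_order all_algebra.
From mathcomp Require Import complex sesquilinear.
From mathcomp Require Import all_classical all_reals all_analysis.

Set Implicit Arguments.
Unset Strict Implicit.
Unset Printing Implicit Defensive.

Import Order.TTheory GRing.Theory Num.Theory.
Import numFieldNormedType.Exports.

Local Open Scope classical_set_scope.
Local Open Scope ring_scope.

Section LinearAlgebra.
Context (R : realType) (V : lmodType R[i]).
Implicit Type s : seq V.

(* As a family: a sequence with a repetition is dependent. *)
Definition lin_dep s : Prop :=
  exists c : 'I_(size s) -> R[i],
    (exists i, c i != 0) /\ \sum_i c i *: s`_i = 0.

Definition lin_indep s : Prop := ~ lin_dep s.

Definition in_span s (x : V) : Prop :=
  exists c : 'I_(size s) -> R[i], x = \sum_i c i *: s`_i.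

Definition dim_ge (n : nat) : Prop := exists s : n.-tuple V, lin_indep s.

End LinearAlgebra.

(* [nip x y s] is <x, y | x_2, ..., x_n> with s = (x_2, ..., x_n).  The order on
   R[i] makes [0 <= z] mean that z is real and nonnegative. *)
Record nInnerProduct (R : realType) (n : nat) (H : lmodType R[i]) :=
  NInnerProduct {
    nip :> H -> H -> n.-1.-tuple H -> R[i];
    nip_dim : dim_ge H n;
    nip_ge0 : forall x s, 0 <= nip x x s;
    nip_eq0 : forall x s, nip x x s = 0 <-> lin_dep (x :: s);
    nip_perm : forall x y (s t : n.-1.-tuple H),
      perm_eq s t -> nip x y s = nip x y t;
    nip_conj : forall x y s, nip x y s = Num.conj (nip y x s);
    nip_scale : forall c x y s, nip (c *: x) y s = c * nip x y s;
    nip_add : forall x x' y s, nip (x + x') y s = nip x y s + nip x' y s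
  }.

Section NHilbert.
Context (R : realType) (n : nat) (H : lmodType R[i]).
Context (ip : nInnerProduct n H).

Definition nnorm (x : H) (s : n.-1.-tuple H) : R :=
  Num.sqrt (complex.Re (ip x x s)).

Definition nHilbert : Prop :=
  forall x_ : nat -> H,
    (forall e : n.-1.-tuple H,
       nnorm (x_ lk.1 - x_ lk.2) e @[lk --> (\oo, \oo)] --> (0 : R)) ->
    exists x : H, forall e : n.-1.-tuple H,
      nnorm (x_ k - x) e @[k --> \oo] --> (0 : R).

End NHilbert.

Section Hilbert.
Context (R : realType) (K : lmodType R[i]) (dot : {dot K for Num.conj}).

Definition hnorm (x : K) : R := Num.sqrt (complex.Re (dot x x)).

Definition hilbert : Prop :=
  forall x_ : nat -> K,
    hnorm (x_ lk.1 - x_ lk.2) @[lk --> (\oo, \oo)] --> (0 : R) ->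
    exists x : K, hnorm (x_ k - x) @[k --> \oo] --> (0 : R).

Definition dense_in (D : set K) : Prop :=
  forall (x : K) (e : R), 0 < e -> exists2 y, D y & hnorm (x - y) < e.

End Hilbert.

(* (K, dot) is the Hilbert space completion of H / span(a) for the inner product
   induced by <x, y | a>; iota is the composite H -> H / span(a) -> K.  The
   completion is determined up to a unique isometry commuting with iota. *)
Record nip_completion (R : realType) (n : nat) (H : lmodType R[i])
    (ip : nInnerProduct n H) (a : n.-1.-tuple H)
    (K : lmodType R[i]) (dot : {dot K for Num.conj}) (iota : {linear H -> K}) :
    Prop := NipCompletion {
  completion_hilbert : hilbert dot;
  completion_ker : forall x, iota x = 0 <-> in_span a x;
  completion_dot : forall x y, dot (iota x) (iota y) = ip x y a;
  completion_dense : dense_in dot (range iota)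
}.

(* (T, dot) is the Hilbert space tensor product of K1 and K2, with tens x y the
   elementary tensor of x and y. *)
Record hilbert_tensor (R : realType) (K1 K2 T : lmodType R[i])
    (dot1 : {dot K1 for Num.conj}) (dot2 : {dot K2 for Num.conj})
    (dot : {dot T for Num.conj}) (tens : {bilinear K1 -> K2 -> T}) : Prop :=
  HilbertTensor {
  tensor_hilbert : hilbert dot;
  tensor_dot : forall x y x' y',
    dot (tens x y) (tens x' y') = dot1 x x' * dot2 y y';
  tensor_dense : dense_in dot
    [set z | exists (m : nat) (x : 'I_m -> K1) (y : 'I_m -> K2),
               z = \sum_i tens (x i) (y i)]
}.

Section ComplexIntegral.
Context (R : realType) d (X : measurableType d).
Context (mu : {measure set X -> \bar R}).
Implicit Type f : X -> R[i].

Definition cmeasurable f : Prop :=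
  measurable_fun setT (fun x => complex.Re (f x)) /\
  measurable_fun setT (fun x => complex.Im (f x)).

Definition cintegrable f : Prop :=
  mu.-integrable setT (fun x => (complex.Re (f x))%:E) /\
  mu.-integrable setT (fun x => (complex.Im (f x))%:E).

Definition cintegral f : R[i] :=
  ((\int[mu]_x complex.Re (f x))%R +i* (\int[mu]_x complex.Im (f x))%R)%C.

(* The integral exists (as a Lebesgue integral) and its value is v. *)
Definition has_cintegral f (v : R[i]) : Prop :=
  cintegrable f /\ cintegral f = v.

Definition sq_integral f : \bar R := (\int[mu]_x ((complex.Re `|f x|) ^+ 2)%:E)%E.

End ComplexIntegral.

Section NFrames.
Context (R : realType) (n : nat) (H : lmodType R[i]).
Context (ip : nInnerProduct n H) (a : n.-1.-tuple H).
Context d (X : measurableType d).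
Context (mu : {measure set X -> \bar R}).

Definition nframe (F : X -> H) : Prop :=
  (forall f : H, cmeasurable (fun x => ip f (F x) a)) /\
  exists A B : R, [/\ 0 < A, A <= B & forall f : H,
    ((A * nnorm ip f a ^+ 2)%:E <= sq_integral mu (fun x => ip f (F x) a))%E /\
    (sq_integral mu (fun x => ip f (F x) a) <= (B * nnorm ip f a ^+ 2)%:E)%E].

(* G is a dual of the frame F; that F is a frame is not part of the predicate. *)
Definition dual_nframe (G F : X -> H) : Prop :=
  nframe G /\
  forall f g : H,
    has_cintegral mu (fun x => ip f (F x) a * ip (G x) g a) (ip f g a).

End NFrames.

(* The elementary tensor of x : H1 and y : H2, identified with its image in the
   Hilbert space tensor product of the completions. *)
Definition etensor (R : realType) (H1 H2 HF HG T : lmodType R[i])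
    (iF : {linear H1 -> HF}) (iG : {linear H2 -> HG})
    (tens : {bilinear HF -> HG -> T}) (x : H1) (y : H2) : T :=
  tens (iF x) (iG y).

(* On elementary tensors the inner product of HF ⊗ HG is the tensor n-inner
   product <., . | a_2 ⊗ b_2, ..., a_n ⊗ b_n>, and its norm is the
   corresponding n-norm. *)
Section ElementaryTensors.
Context (R : realType) (n : nat) (H1 H2 HF HG T : lmodType R[i]).
Context (ip1 : nInnerProduct n H1) (ip2 : nInnerProduct n H2).
Context (a : n.-1.-tuple H1) (b : n.-1.-tuple H2).
Context (dotF : {dot HF for Num.conj}) (iF : {linear H1 -> HF}).
Context (dotG : {dot HG for Num.conj}) (iG : {linear H2 -> HG}).
Context (dotT : {dot T for Num.conj}) (tens : {bilinear HF -> HG -> T}).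
Context (hF : nip_completion ip1 a dotF iF)
  (hG : nip_completion ip2 b dotG iG)
  (hT : hilbert_tensor dotF dotG dotT tens).

Lemma etensor_dot f g f1 g1 :
  dotT (etensor iF iG tens f g) (etensor iF iG tens f1 g1) =
  ip1 f f1 a * ip2 g g1 b.
Proof.
by rewrite /etensor (tensor_dot hT) (completion_dot hF) (completion_dot hG).
Qed.

Lemma etensor_norm f g :
  hnorm dotT (etensor iF iG tens f g) = nnorm ip1 f a * nnorm ip2 g b.
Proof.
rewrite /hnorm /nnorm etensor_dot.
have := nip_ge0 ip1 f a; have := nip_ge0 ip2 g b.
case: (ip1 f f a) (ip2 g g b) => [u u'] [v v'].
rewrite !lecE /= => /andP[/eqP-> _] /andP[/eqP-> u0].
by rewrite mulr0 subr0 sqrtrM.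
Qed.

End ElementaryTensors.

Section TensorFrames.
Context (R : realType) (H1 H2 HF HG T : lmodType R[i]).
Context (iF : {linear H1 -> HF}) (iG : {linear H2 -> HG}).
Context (dotT : {dot T for Num.conj}) (tens : {bilinear HF -> HG -> T}).
Context d (X : measurableType d).
Context (mu : {measure set X -> \bar R}).
Local Notation "f ⊗ g" := (etensor iF iG tens f g) (at level 40).

Definition tensor_frame (F : X -> T) : Prop :=
  (forall f g, cmeasurable (fun x => dotT (f ⊗ g) (F x))) /\
  exists A B : R, [/\ 0 < A, 0 < B & forall f g,
    ((A * hnorm dotT (f ⊗ g) ^+ 2)%:E <=
       sq_integral mu (fun x => dotT (f ⊗ g) (F x)))%E /\
    (sq_integral mu (fun x => dotT (f ⊗ g) (F x)) <=
       (B * hnorm dotT (f ⊗ g) ^+ 2)%:E)%E].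

(* The last clause is f ⊗ g = \int <f ⊗ g, F x> G x dmu in T, the integral being
   taken weakly, i.e. after pairing with an arbitrary h in T. *)
Definition dual_tensor_frame (G F : X -> T) : Prop :=
  [/\ tensor_frame F, tensor_frame G & forall f g (h : T),
    has_cintegral mu (fun x => dotT (f ⊗ g) (F x) * dotT (G x) h)
      (dotT (f ⊗ g) h)].

End TensorFrames.

(* Main.v *)
Require Import Defs.
From mathcomp Require Import all_boot all_order all_algebra.
From mathcomp Require Import complex sesquilinear.
From mathcomp Require Import all_classical all_reals all_analysis.
From mathcomp Require Import measurable_realfun.
From mathcomp Require Import ring lra.

Import Order.TTheory GRing.Theory Num.Theory.
Import numFieldNormedType.Exports.

Local Open Scope classical_set_scope.
Local Open Scope ring_scope.

(** On elementary tensors everything factors: <f ⊗ g, F1 x1 ⊗ F2 x2> is a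
    function of x1 times a function of x2, so by Tonelli the frame integrals
    multiply, and with them the frame bounds ([nframe_tensor]); by Fubini the
    two reconstruction formulas multiply as well ([has_cintegral_tensor]), which
    gives the weak identity f ⊗ g = \int <f ⊗ g, F> G when it is tested against
    finite sums of elementary tensors.

    What remains is to test against an arbitrary h in the completed tensor
    product T. Such sums are dense, but passing to the limit under the integral
    needs a bound on \int |<h, G>|^2 by a multiple of ||h||^2 for every h,
    whereas the frame inequalities only speak of elementary h. This is the Bessel
    property of a tensor product of Bessel maps ([bessel_tensor]). A finite sum
    of elementary tensors can be rewritten as \sum_i x_i ⊗ y_i with the y_i
    pairwise orthogonal ([orthogonal_tensor_sum]). For fixed x1, its pairing
    with Phi1 x1 ⊗ Phi2 x2 is <\sum_i <x_i, Phi1 x1> y_i, Phi2 x2>; the bound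
    for Phi2 and the Pythagorean identity bound its square integral over X2 by
    B2 \sum_i |<x_i, Phi1 x1>|^2 ||y_i||^2, and integrating over X1 gives
    B1 B2 \sum_i ||x_i||^2 ||y_i||^2, which is B1 B2 times the squared norm of
    the sum.

    Two closure principles carry statements from a dense subset to a whole
    pre-Hilbert space: Bessel bounds extend by Fatou ([bessel_dense]), and
    weak integral representations extend because they are continuous in the
    test vector once a Bessel bound is known ([has_cintegral_bessel]). Each is
    used twice: from H to its completion, and from finite sums of elementary
    tensors to T. *)

Set Implicit Arguments.
Unset Strict Implicit.
Unset Printing Implicit Defensive.

Local Notation Re := complex.Re.
Local Notation Im := complex.Im.

(** * Squared modulus of a complex number *)

Section ComplexModulus.
Context (R : realType).
Implicit Types z w : R[i].

(** The integrand of [sq_integral], kept real-valued so that it can be measured. *)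
Definition sqmod z : R := Re `|z| ^+ 2.

Lemma sqmodE z : sqmod z = Re z ^+ 2 + Im z ^+ 2.
Proof.
by rewrite /sqmod normc_def /= sqr_sqrtr// addr_ge0// sqr_ge0.
Qed.

Lemma sqmod_ge0 z : 0 <= sqmod z.
Proof. exact: sqr_ge0. Qed.

Lemma normc_sqmod z : `|z| ^+ 2 = (sqmod z)%:C%C.
Proof. by rewrite -add_Re2_Im2 sqmodE. Qed.

Lemma complexReM z w : Re (z * w) = Re z * Re w - Im z * Im w.
Proof. by case: z w => [? ?] [? ?]. Qed.

Lemma complexImM z w : Im (z * w) = Re z * Im w + Im z * Re w.
Proof. by case: z w => [? ?] [? ?]. Qed.

Lemma complexReD z w : Re (z + w) = Re z + Re w.
Proof. by case: z w => [? ?] [? ?]. Qed.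

Lemma complexImD z w : Im (z + w) = Im z + Im w.
Proof. by case: z w => [? ?] [? ?]. Qed.

Lemma complexReB z w : Re (z - w) = Re z - Re w.
Proof. by case: z w => [? ?] [? ?]. Qed.

Lemma complexImB z w : Im (z - w) = Im z - Im w.
Proof. by case: z w => [? ?] [? ?]. Qed.

Lemma complexRe_conj z : Re (Num.conj z) = Re z.
Proof. by case: z. Qed.

Lemma complexIm_conj z : Im (Num.conj z) = - Im z.
Proof. by case: z. Qed.

Lemma sqmodM z w : sqmod (z * w) = sqmod z * sqmod w.
Proof. by rewrite !sqmodE complexReM complexImM; ring. Qed.

Lemma sqmod_conj z : sqmod (Num.conj z) = sqmod z.
Proof. by rewrite !sqmodE complexRe_conj complexIm_conj sqrrN. Qed.

Lemma normr_sqmod_le (z : R[i]) (c : R) : 0 <= c -> sqmod z <= c ^+ 2 ->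
  `|Re z| <= c /\ `|Im z| <= c.
Proof.
rewrite sqmodE => c0 zc; split.
- rewrite -(@ler_pXn2r _ 2)// ?nnegrE// real_normK ?num_real//.
  by apply: le_trans zc; rewrite lerDl sqr_ge0.
- rewrite -(@ler_pXn2r _ 2)// ?nnegrE// real_normK ?num_real//.
  by apply: le_trans zc; rewrite lerDr sqr_ge0.
Qed.

End ComplexModulus.

(** * Convergence of real sequences and integrals *)

Section Limits.
Context (R : realType).

Lemma cvg_le_dist (u_ v_ : nat -> R) (l c : R) : v_ k @[k --> \oo] --> (0 : R) ->
  (forall k, `|l - u_ k| <= c * v_ k) -> u_ k @[k --> \oo] --> l.
Proof.
move=> v0 uv; rewrite -[l]addr0 -oppr0.
have -> : u_ = (fun k => l - (l - u_ k)).
  by apply/funext => k; rewrite subKr.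
apply: cvgB; first exact: cvg_cst.
apply/norm_cvg0P; apply: (@squeeze_cvgr _ _ _ _ (fun=> 0) (fun k => c * v_ k)).
- by near=> k; rewrite normr_ge0 uv.
- exact: cvg_cst.
- by rewrite -[X in _ --> X](mulr0 c); apply: cvgM => //; exact: cvg_cst.
Unshelve. all: by end_near. Qed.

(** Fatou's lemma when the functions converge: the limit is then their lower
    limit, and the lower limit of the integrals is at most that of any bounds. *)
Lemma fatou_cvg d (X : measurableType d)
  (mu : {measure set X -> \bar R}) (f_ : nat -> X -> \bar R) (f : X -> \bar R)
  (c_ : nat -> R) (c : R) :
  (forall k, measurable_fun setT (f_ k)) -> (forall k x, 0 <= f_ k x)%E ->
  (forall x, f_ k x @[k --> \oo] --> f x) ->
  (forall k, \int[mu]_x f_ k x <= (c_ k)%:E)%E -> c_ k @[k --> \oo] --> c ->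
  (\int[mu]_x f x <= c%:E)%E.
Proof.
move=> mf f0 ff fc cc.
have -> : f = (fun x => limn_einf (fun k => f_ k x)).
  by apply/funext => x; rewrite limn_einf_lim; apply/esym/cvg_lim => //; exact: cvg_einfs.
apply: (le_trans (fatou mu measurableT mf (fun k x _ => f0 k x))).
rewrite limn_einf_lim.
have cl : (EFin \o c_) k @[k --> \oo] --> c%:E by apply: cvg_EFin => //; exact: nearW.
rewrite -(cvg_lim _ cl)//; apply: lee_lim; first exact: is_cvg_einfs.
  by apply/cvg_ex; exists c%:E.
apply: nearW => k /=; apply: le_trans (fc k).
by apply: ereal_inf_lbound; exists k => //=.
Qed.

End Limits.

(** * Norm and inner product *)

Section InnerProduct.
Context (R : realType) (K : lmodType R[i]) (dot : {dot K for Num.conj}).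
Implicit Types x y z : K.

Lemma dot_conj x y : dot x y = Num.conj (dot y x).
Proof. by rewrite (hermC dot x y) /= mul1r. Qed.

Lemma hnorm_ge0 x : 0 <= hnorm dot x.
Proof. exact: sqrtr_ge0. Qed.

Lemma hnorm_sqr x : hnorm dot x ^+ 2 = Re (dot x x).
Proof.
by rewrite /hnorm sqr_sqrtr//; have := dnorm_ge0 dot x; rewrite lecE => /andP[].
Qed.

Lemma dotxx x : dot x x = (hnorm dot x ^+ 2)%:C%C.
Proof.
rewrite hnorm_sqr; have := dnorm_ge0 dot x.
by rewrite lecE; case: (dot x x) => r i /= /andP[/eqP -> _].
Qed.

(** Decompose x as the multiple of y that is its projection, plus a vector
    orthogonal to y, and drop the latter in the Pythagorean identity. *)
Lemma Cauchy_Schwarz x y :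
  sqmod (dot x y) <= hnorm dot x ^+ 2 * hnorm dot y ^+ 2.
Proof.
rewrite -lecR -normc_sqmod rmorphM /= -!dotxx.
have [->|y0] := eqVneq y 0; first by rewrite !linear0r normr0 expr0n /= lexx.
pose a := dot x y / dot y y; pose u := x - a *: y.
have ou : dot u y = 0.
  by rewrite linearBl /= linearZl_LR /= divfK ?dnorm_eq0// subrr.
have -> : x = u + a *: y by rewrite subrK.
rewrite linearDl /= ou add0r linearZl_LR /= normrM (ger0_norm (dnorm_ge0 dot y)).
have ouy : dot u (a *: y) = 0 by rewrite linearZr_LR /= ou mulr0.
rewrite exprMn [dot y y ^+ 2]expr2 mulrA -dnormZ (hnormDd ouy).
by rewrite ler_wpM2r// lerDr dnorm_ge0.
Qed.

Lemma normr_dot_le x y :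
  `|Re (dot x y)| <= hnorm dot x * hnorm dot y /\
  `|Im (dot x y)| <= hnorm dot x * hnorm dot y.
Proof.
apply: normr_sqmod_le; first by rewrite mulr_ge0 ?hnorm_ge0.
by rewrite exprMn Cauchy_Schwarz.
Qed.

Lemma ler_hnormD x y : hnorm dot (x + y) <= hnorm dot x + hnorm dot y.
Proof.
rewrite -(@ler_pXn2r _ 2)// ?nnegrE ?addr_ge0 ?hnorm_ge0//.
rewrite sqrrD hnorm_sqr dnormD !complexReD complexRe_conj -!hnorm_sqr.
have [/(le_trans (ler_norm _)) xy _] := normr_dot_le x y.
rewrite mulr2n; lra.
Qed.

Lemma hnorm_opp x : hnorm dot (- x) = hnorm dot x.
Proof. by rewrite /hnorm hnormN. Qed.

Lemma hnormBC x y : hnorm dot (x - y) = hnorm dot (y - x).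
Proof. by rewrite -hnorm_opp opprB. Qed.

Lemma hnorm_dist x y : `|hnorm dot x - hnorm dot y| <= hnorm dot (x - y).
Proof.
rewrite ler_norml; apply/andP; split.
  rewrite lerNl opprB lerBlDr (hnormBC x); apply: le_trans (ler_hnormD _ _).
  by rewrite subrK.
by rewrite lerBlDr; apply: le_trans (ler_hnormD _ _); rewrite subrK.
Qed.

Lemma hnorm_sqrZ (c : R[i]) x : hnorm dot (c *: x) ^+ 2 = sqmod c * hnorm dot x ^+ 2.
Proof.
by rewrite hnorm_sqr dnormZ normc_sqmod dotxx complexReM /= mul0r subr0.
Qed.

Lemma hnorm_sum_orthogonal m (x : 'I_m -> K) :
  (forall i j, i != j -> dot (x i) (x j) = 0) ->
  hnorm dot (\sum_i x i) ^+ 2 = \sum_i hnorm dot (x i) ^+ 2.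
Proof.
elim: m x => [|m IH] x ox; first by rewrite !big_ord0 hnorm_sqr linear0r.
rewrite !big_ord_recl -IH; last first.
  by move=> i j ij; apply: ox; rewrite (inj_eq lift_inj).
have o0 : dot (x ord0) (\sum_i x (lift ord0 i)) = 0.
  by rewrite linear_sumr big1// => i _; apply: ox; rewrite neq_lift.
by rewrite !hnorm_sqr (hnormDd o0) complexReD.
Qed.

Lemma dense_seq (D : set K) x : dense_in dot D ->
  exists2 y_ : nat -> K, forall k, D (y_ k) &
    hnorm dot (x - y_ k) @[k --> \oo] --> (0 : R).
Proof.
move=> dD.
have /choice[y_ Dy] : forall k : nat, exists y, D y /\ hnorm dot (x - y) < k.+1%:R^-1.
  by move=> k; have [|y Dy xy] := dD x k.+1%:R^-1; [rewrite invr_gt0 ltr0n|exists y].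
exists y_ => [k|]; first by have [] := Dy k.
apply: (@squeeze_cvgr _ _ _ _ (fun=> 0) (@harmonic R)).
- by near=> k; rewrite hnorm_ge0 ltW//; have [] := Dy k.
- exact: cvg_cst.
- exact: cvg_harmonic.
Unshelve. all: by end_near. Qed.

Lemma cvg_hnorm (y_ : nat -> K) x :
  hnorm dot (x - y_ k) @[k --> \oo] --> (0 : R) ->
  hnorm dot (y_ k) @[k --> \oo] --> hnorm dot x.
Proof.
by move=> y0; apply: (cvg_le_dist (c := 1) y0) => k; rewrite mul1r hnorm_dist.
Qed.

Lemma cvg_dot (y_ : nat -> K) x z :
  hnorm dot (x - y_ k) @[k --> \oo] --> (0 : R) ->
  Re (dot (y_ k) z) @[k --> \oo] --> Re (dot x z) /\
  Im (dot (y_ k) z) @[k --> \oo] --> Im (dot x z).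
Proof.
move=> y0; split; apply: (cvg_le_dist (c := hnorm dot z) y0) => k.
  by rewrite -complexReB -linearBl mulrC; have [] := normr_dot_le (x - y_ k) z.
by rewrite -complexImB -linearBl mulrC; have [] := normr_dot_le (x - y_ k) z.
Qed.

End InnerProduct.

(** * Square integrals of complex functions *)

Section ComplexMeasurability.
Context (R : realType) d (X : measurableType d).
Implicit Types f g : X -> R[i].

Lemma cmeasurableM f g :
  cmeasurable f -> cmeasurable g -> cmeasurable (fun x => f x * g x).
Proof.
move=> [f1 f2] [g1 g2]; split.
  under eq_fun do rewrite complexReM.
  by apply: measurable_funB; exact: measurable_funM.
under eq_fun do rewrite complexImM.
by apply: measurable_funD; exact: measurable_funM.
Qed.

Lemma cmeasurable_conj f :
  cmeasurable f -> cmeasurable (fun x => Num.conj (f x)).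
Proof.
move=> [f1 f2]; split; first by under eq_fun do rewrite complexRe_conj.
under eq_fun do rewrite complexIm_conj.
exact: measurableT_comp.
Qed.

Lemma cmeasurable_sum m (f_ : 'I_m -> X -> R[i]) :
  (forall i, cmeasurable (f_ i)) -> cmeasurable (fun x => \sum_i f_ i x).
Proof.
move=> mf; elim: m f_ mf => [|m IH] f_ mf.
  by split; under eq_fun do rewrite big_ord0; exact: measurable_cst.
have [IH1 IH2] := IH (fun i => f_ (lift ord0 i)) (fun i => mf _).
have [mf1 mf2] := mf ord0.
split; under eq_fun do rewrite big_ord_recl ?complexReD ?complexImD.
  exact: measurable_funD.
exact: measurable_funD.
Qed.

Lemma measurable_sqmod f :
  cmeasurable f -> measurable_fun setT (fun x => sqmod (f x)).
Proof.
move=> [f1 f2]; under eq_fun do rewrite sqmodE.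
by apply: measurable_funD; exact: measurable_funX.
Qed.

Lemma measurable_sqmodE f :
  cmeasurable f -> measurable_fun setT (fun x => (sqmod (f x))%:E).
Proof. by move=> mf; apply/measurable_EFinP; exact: measurable_sqmod. Qed.

End ComplexMeasurability.

Section ComplexIntegration.
Context (R : realType) d (X : measurableType d).
Context (mu : {measure set X -> \bar R}).
Implicit Types f g : X -> R[i].

Lemma has_cintegralD f g v w :
  has_cintegral mu f v -> has_cintegral mu g w ->
  has_cintegral mu (fun x => f x + g x) (v + w).
Proof.
move=> [[f1 f2] <-] [[g1 g2] <-]; split.
  split.
    by under eq_fun do rewrite complexReD EFinD; exact: integrableD.
  by under eq_fun do rewrite complexImD EFinD; exact: integrableD.
rewrite /cintegral; under eq_Rintegral do rewrite complexReD.
rewrite RintegralD//.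
under [X in (_ +i* X)%C]eq_Rintegral do rewrite complexImD.
by rewrite RintegralD.
Qed.

Lemma has_cintegral_sum m (f_ : 'I_m -> X -> R[i]) (v_ : 'I_m -> R[i]) :
  (forall i, has_cintegral mu (f_ i) (v_ i)) ->
  has_cintegral mu (fun x => \sum_i f_ i x) (\sum_i v_ i).
Proof.
elim: m f_ v_ => [|m IH] f_ v_ fv.
  rewrite big_ord0; under eq_fun do rewrite big_ord0.
  split; first by split; exact: integrable0.
  by rewrite /cintegral/= /Rintegral integral0.
rewrite big_ord_recl; under eq_fun do rewrite big_ord_recl.
by apply: has_cintegralD => //; apply: IH => i; exact: fv.
Qed.

(** A Cauchy-Schwarz estimate in Young's form, with a free weight t: no square
    roots of integrals occur, and when N is of order t ^+ 2 the bound is of order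
    t, which is how it yields continuity in [has_cintegral_bessel]. *)
Lemma integral_young (t M N : R) f g (h : X -> R) :
  0 < t -> cmeasurable f -> cmeasurable g ->
  (sq_integral mu f <= M%:E)%E -> (sq_integral mu g <= N%:E)%E ->
  measurable_fun setT h ->
  (forall x, `|h x| <= t * sqmod (f x) + t^-1 * sqmod (g x)) ->
  mu.-integrable setT (EFin \o h) /\
  `|(\int[mu]_x h x)%R| <= t * M + t^-1 * N.
Proof.
move=> t0 mf mg fM gN mh hle.
have t'0 : 0 <= t^-1 by rewrite invr_ge0 ltW.
have hi : (\int[mu]_x `|(h x)%:E| <= (t * M + t^-1 * N)%:E)%E.
  apply: (@le_trans _ _
      (\int[mu]_x (t%:E * (sqmod (f x))%:E + t^-1%:E * (sqmod (g x))%:E))%E).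
    apply: ge0_le_integral => //.
    - by apply: measurableT_comp => //; exact/measurable_EFinP.
    - by apply: emeasurable_funD; apply: measurable_funeM; exact: measurable_sqmodE.
    - by move=> x _; rewrite -!EFinM -EFinD lee_fin hle.
  rewrite ge0_integralD//.
  - rewrite !ge0_integralZl ?lee_fin ?(ltW t0)//.
    + by rewrite EFinD !EFinM leeD// lee_wpmul2l// lee_fin ltW.
    + exact: measurable_sqmodE.
    + by move=> x _; rewrite lee_fin sqmod_ge0.
    + exact: measurable_sqmodE.
    + by move=> x _; rewrite lee_fin sqmod_ge0.
  - by move=> x _; rewrite mule_ge0 ?lee_fin ?sqmod_ge0// ltW.
  - by apply: measurable_funeM; exact: measurable_sqmodE.
  - by move=> x _; rewrite mule_ge0 ?lee_fin ?sqmod_ge0.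
  - by apply: measurable_funeM; exact: measurable_sqmodE.
have ih : mu.-integrable setT (EFin \o h).
  apply/integrableP; split; first exact/measurable_EFinP.
  exact: le_lt_trans hi (ltry _).
split=> //; rewrite -lee_fin EFin_normr_Rintegral//; apply: le_trans hi.
by apply: le_abse_integral => //; exact/measurable_EFinP.
Qed.

Lemma cintegral_young (t M N : R) f g :
  0 < t -> cmeasurable f -> cmeasurable g ->
  (sq_integral mu f <= M%:E)%E -> (sq_integral mu g <= N%:E)%E ->
  exists v, has_cintegral mu (fun x => f x * g x) v /\
    `|Re v| <= t * M + t^-1 * N /\ `|Im v| <= t * M + t^-1 * N.
Proof.
move=> t0 mf mg fM gN; have [m1 m2] := cmeasurableM mf mg.
have young (p q r s : R) :
    `|p * q + r * s| <= t * (p ^+ 2 + r ^+ 2) + t^-1 * (q ^+ 2 + s ^+ 2).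
  (* Expand 0 <= t * (x - e * t^-1 * y) ^+ 2; the sign e handles both sides of
     the absolute value. *)
  have aux (e x y : R) : e ^+ 2 = 1 -> e * (x * y) <= t * x ^+ 2 + t^-1 * y ^+ 2.
    move=> e1; have : 0 <= t * (x - e * t^-1 * y) ^+ 2.
      by rewrite mulr_ge0 ?sqr_ge0 ?ltW.
    have : 0 <= t * x ^+ 2 by rewrite mulr_ge0 ?sqr_ge0 ?ltW.
    have : 0 <= t^-1 * y ^+ 2 by rewrite mulr_ge0 ?sqr_ge0 ?invr_ge0 ?ltW.
    have -> : t * (x - e * t^-1 * y) ^+ 2 =
        t * x ^+ 2 - 2 * (e * (x * y)) + e ^+ 2 * (t^-1 * y ^+ 2).
      by field; rewrite gt_eqF.
    rewrite e1; lra.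
  have := aux 1 p q (expr1n _ _); have := aux 1 r s (expr1n _ _).
  have N1 : (-1 : R) ^+ 2 = 1 by rewrite sqrrN expr1n.
  have := aux (-1) p q N1; have := aux (-1) r s N1.
  by rewrite ler_norml => ? ? ? ?; apply/andP; split; lra.
have [|i1 b1] := integral_young t0 mf mg fM gN m1.
  by move=> x; rewrite !sqmodE complexReM -mulNr (le_trans (young _ _ _ _))// sqrrN.
have [|i2 b2] := integral_young t0 mf mg fM gN m2.
  move=> x; rewrite !sqmodE complexImM (le_trans (young _ _ _ _))//.
  by rewrite [X in _ + _ * X <= _]addrC.
by exists (cintegral mu (fun x => f x * g x)).
Qed.

Lemma sq_integral_conj f :
  sq_integral mu (fun x => Num.conj (f x)) = sq_integral mu f.
Proof. by apply: eq_integral => x _; congr EFin; exact: sqmod_conj. Qed.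

End ComplexIntegration.

(** * Tonelli and Fubini for products of complex functions *)

Section Products.
Context (R : realType) d1 d2 (X1 : measurableType d1) (X2 : measurableType d2).
Context (mu1 : {sigma_finite_measure set X1 -> \bar R}).
Context (mu2 : {sigma_finite_measure set X2 -> \bar R}).
Implicit Types (u : X1 -> R[i]) (v : X2 -> R[i]).

Lemma cmeasurable_tensor u v : cmeasurable u -> cmeasurable v ->
  cmeasurable (fun x : X1 * X2 => u x.1 * v x.2).
Proof.
move=> [u1 u2] [v1 v2]; apply: cmeasurableM; split.
- exact: measurableT_comp u1 measurable_fst.
- exact: measurableT_comp u2 measurable_fst.
- exact: measurableT_comp v1 measurable_snd.
- exact: measurableT_comp v2 measurable_snd.
Qed.

(** Tonelli: |u(x1) v(x2)|^2 is a product of one-variable functions. *)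
Lemma sq_integral_tensor u v : cmeasurable u -> cmeasurable v ->
  sq_integral (mu1 \x mu2)%E (fun x : X1 * X2 => u x.1 * v x.2) =
  (sq_integral mu1 u * sq_integral mu2 v)%E.
Proof.
move=> mu_ mv_; rewrite /sq_integral.
rewrite (fubini_tonelli1 (fun x : X1 * X2 => (sqmod (u x.1 * v x.2))%:E)); last 2 first.
  exact/measurable_sqmodE/cmeasurable_tensor.
  by move=> x; rewrite lee_fin sqmod_ge0.
rewrite /fubini_F /=.
under eq_integral => x _.
  under eq_integral do rewrite sqmodM EFinM.
  rewrite ge0_integralZl//; first over.
  - exact: measurable_sqmodE.
  - by move=> y _; rewrite lee_fin sqmod_ge0.
  - by rewrite lee_fin sqmod_ge0.
rewrite ge0_integralZr//.
- exact: measurable_sqmodE.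
- by move=> y _; rewrite lee_fin sqmod_ge0.
- by apply: integral_ge0 => x _; rewrite lee_fin sqmod_ge0.
Qed.

Lemma integrable_tensor (u : X1 -> R) (v : X2 -> R) :
  mu1.-integrable setT (EFin \o u) -> mu2.-integrable setT (EFin \o v) ->
  (mu1 \x mu2)%E.-integrable setT (fun x => (u x.1 * v x.2)%:E).
Proof.
move=> /integrableP[/measurable_EFinP mu ui] /integrableP[/measurable_EFinP mv vi].
apply/integrable12ltyP.
  by apply/measurable_EFinP; apply: measurable_funM; exact: measurableT_comp.
under eq_integral => x _.
  under eq_integral do rewrite /= normrM EFinM.
  rewrite ge0_integralZl//; first over.
  by apply/measurable_EFinP; exact: measurableT_comp.
rewrite ge0_integralZr//=.
- by rewrite lte_mul_pinfty// ?ge0_fin_numE//; exact: integral_ge0.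
- by apply/measurable_EFinP; exact: measurableT_comp.
- exact: integral_ge0.
Qed.

Lemma Rintegral_tensor (u : X1 -> R) (v : X2 -> R) :
  mu1.-integrable setT (EFin \o u) -> mu2.-integrable setT (EFin \o v) ->
  (\int[(mu1 \x mu2)%E]_x (u x.1 * v x.2) =
   (\int[mu1]_x u x) * (\int[mu2]_x v x))%R.
Proof.
move=> ui vi; rewrite {1}/Rintegral -integral12_prod_meas1; last first.
  exact: integrable_tensor.
rewrite /fubini_F /=.
under eq_integral => x _.
  under eq_integral do rewrite EFinM.
  rewrite integralZl//.
  rewrite -[X in (_ * X)%E](fineK (integrable_fin_num measurableT vi)).
  over.
rewrite integralZr//.
rewrite -[X in (X * _)%E](fineK (integrable_fin_num measurableT ui)).
by [].
Qed.

(** Fubini, applied to the four real products in the real and imaginary parts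
    of u * v. *)
Lemma has_cintegral_tensor u v a b :
  has_cintegral mu1 u a -> has_cintegral mu2 v b ->
  has_cintegral (mu1 \x mu2)%E (fun x : X1 * X2 => u x.1 * v x.2) (a * b).
Proof.
move=> [[u1 u2] <-] [[v1 v2] <-].
have i11 := integrable_tensor u1 v1; have i12 := integrable_tensor u1 v2.
have i21 := integrable_tensor u2 v1; have i22 := integrable_tensor u2 v2.
split.
  split.
    under eq_fun do rewrite complexReM EFinB; exact: integrableB.
  under eq_fun do rewrite complexImM EFinD; exact: integrableD.
rewrite /cintegral; under eq_Rintegral do rewrite complexReM.
under [X in (_ +i* X)%C]eq_Rintegral do rewrite complexImM.
rewrite RintegralB// RintegralD//.
rewrite (Rintegral_tensor u1 v1) (Rintegral_tensor u1 v2).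
by rewrite (Rintegral_tensor u2 v1) (Rintegral_tensor u2 v2).
Qed.

End Products.

(** * Bessel maps *)

Section BesselMaps.
Context (R : realType) (K : lmodType R[i]) (dot : {dot K for Num.conj}).
Context d (X : measurableType d) (mu : {measure set X -> \bar R}).

(** The upper half of the frame inequality, on a set D of test vectors. The
    vector y stands on the left as in [nframe], so that the integrand is linear
    in y. *)
Definition bessel (D : set K) (B : R) (Phi : X -> K) : Prop :=
  forall y, D y -> cmeasurable (fun x => dot y (Phi x)) /\
    (sq_integral mu (fun x => dot y (Phi x)) <= (B * hnorm dot y ^+ 2)%:E)%E.

(** Approximate y by vectors of D: the pairings converge pointwise by
    Cauchy-Schwarz, so measurability passes to the limit, and Fatou keeps the
    bound, with the same constant because the norms converge too. *)
Lemma bessel_dense (D : set K) B (Phi : X -> K) :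
  dense_in dot D -> bessel D B Phi -> bessel setT B Phi.
Proof.
move=> dD bD y _; have [y_ Dy y0] := dense_seq y dD.
have cy x := cvg_dot (Phi x) y0.
have my : cmeasurable (fun x => dot y (Phi x)).
  split; [apply: (measurable_fun_cvg (h := fun k x => Re (dot (y_ k) (Phi x))))
         |apply: (measurable_fun_cvg (h := fun k x => Im (dot (y_ k) (Phi x))))].
  - by move=> k; have [[]] := bD _ (Dy k).
  - by move=> x _; have [] := cy x.
  - by move=> k; have [[]] := bD _ (Dy k).
  - by move=> x _; have [] := cy x.
split=> //.
apply: (fatou_cvg (f_ := fun k x => (sqmod (dot (y_ k) (Phi x)))%:E)
  (c_ := fun k => B * hnorm dot (y_ k) ^+ 2)).
- by move=> k; apply: measurable_sqmodE; have [] := bD _ (Dy k).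
- by move=> k x; rewrite lee_fin sqmod_ge0.
- move=> x; apply: cvg_EFin; first exact: nearW.
  rewrite -/(sqmod _) sqmodE /comp /=; under eq_fun do rewrite sqmodE.
  have [c1 c2] := cy x.
  by apply: cvgD; rewrite !expr2; under eq_fun do rewrite expr2; exact: cvgM.
- by move=> k; have [] := bD _ (Dy k).
- apply: cvgM; first exact: cvg_cst.
  rewrite !expr2; under eq_fun do rewrite expr2.
  by apply: cvgM; exact: cvg_hnorm.
Qed.

(** Both sides are continuous in y: the right one by Cauchy-Schwarz, the
    integral because the Bessel bound controls the pairing with y - y' in L^2
    by the norm of y - y'. Hence their equality need only hold on a dense set. *)
Lemma has_cintegral_bessel (D : set K) B M (f : X -> R[i]) (Phi : X -> K) (w : K) :
  dense_in dot D -> 0 <= B -> 0 <= M -> bessel setT B Phi ->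
  cmeasurable f -> (sq_integral mu f <= M%:E)%E ->
  (forall y, D y -> has_cintegral mu (fun x => f x * dot (Phi x) y) (dot w y)) ->
  forall y, has_cintegral mu (fun x => f x * dot (Phi x) y) (dot w y).
Proof.
move=> dD B0 M0 bPhi mf fM hD y.
have bound (z : K) (t : R) : 0 < t ->
    exists v, has_cintegral mu (fun x => f x * dot (Phi x) z) v /\
    `|Re v| <= t * M + t^-1 * (B * hnorm dot z ^+ 2) /\
    `|Im v| <= t * M + t^-1 * (B * hnorm dot z ^+ 2).
  move=> t0; have [mz zB] := bPhi z I.
  have -> : (fun x => f x * dot (Phi x) z) = (fun x => f x * Num.conj (dot z (Phi x))).
    by apply/funext => x; rewrite [dot (Phi x) z]dot_conj.
  apply: cintegral_young => //; first exact: cmeasurable_conj.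
  by rewrite sq_integral_conj.
have [v [hv _]] := bound y 1 ltr01.
suff -> : dot w y = v by [].
have close (e : R) : 0 < e -> `|Re (dot w y - v)| <= e /\ `|Im (dot w y - v)| <= e.
  (* If y' is within t of y, the pairing <w, y - y'> and the two terms of
     [bound] are at most ||w|| t, t M and t B; the summand 1 in C keeps the
     divisor positive. *)
  move=> e0; pose C := M + B + hnorm dot w + 1.
  have C0 : 0 < C by rewrite ltr_pwDr// !addr_ge0// hnorm_ge0.
  pose t := e / C; have t0 : 0 < t by rewrite divr_gt0.
  have [y' Dy' yy'] := dD y t t0.
  have [v' [hv' [v'R v'I]]] := bound (y - y') t t0.
  have vE : v = v' + dot w y'.
    case: hv => _ <-; case: (has_cintegralD hv' (hD _ Dy')) => _ <-.
    by congr cintegral; apply/funext => x; rewrite linearBr mulrBr subrK.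
  have -> : dot w y - v = dot w (y - y') - v'.
    by rewrite vE linearBr opprD addrA addrAC.
  have [dR dI] := normr_dot_le dot w (y - y').
  have y'0 := hnorm_ge0 dot (y - y').
  have le1 : hnorm dot w * hnorm dot (y - y') <= hnorm dot w * t.
    by rewrite ler_wpM2l ?hnorm_ge0// ltW.
  have le2 : t^-1 * (B * hnorm dot (y - y') ^+ 2) <= t * B.
    rewrite ler_pdivrMl//.
    have -> : t * (t * B) = B * t ^+ 2 by ring.
    by rewrite ler_wpM2l// lerXn2r ?nnegrE ?hnorm_ge0 ?(ltW t0) ?(ltW yy').
  have le3 : hnorm dot w * t + (t * M + t * B) <= e.
    have -> : e = t * C by rewrite /t divfK// gt_eqF.
    have -> : t * C = hnorm dot w * t + (t * M + t * B) + t by rewrite /C; ring.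
    by rewrite lerDl ltW.
  split; [rewrite complexReB|rewrite complexImB];
    apply: (le_trans (ler_normB _ _)); apply: le_trans le3; apply: lerD.
  - exact: le_trans le1.
  - by apply: (le_trans v'R); rewrite lerD2l.
  - exact: le_trans le1.
  - by apply: (le_trans v'I); rewrite lerD2l.
apply/eqP; rewrite -subr_eq0; apply/eqP.
have z0 (r : R) : (forall e, 0 < e -> `|r| <= e) -> r = 0.
  move=> re; apply/normr0_eq0/le_anti; rewrite normr_ge0 andbT.
  by apply/ler_addgt0Pl => e e0; rewrite addr0 re.
have rz := z0 _ (fun e e0 => (close e e0).1).
have iz := z0 _ (fun e e0 => (close e e0).2).
by move: rz iz; case: (dot w y - v) => ? ? /= -> ->.
Qed.

End BesselMaps.

(** * Bessel maps into tensor products *)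

Section TensorProduct.
Context (R : realType) (K1 K2 T : lmodType R[i]).
Context (dot1 : {dot K1 for Num.conj}) (dot2 : {dot K2 for Num.conj}).
Context (dotT : {dot T for Num.conj}) (tens : {bilinear K1 -> K2 -> T}).
Context (hT : hilbert_tensor dot1 dot2 dotT tens).

(** Gram-Schmidt on the second factors. When y_0 is replaced by
    y_0 - \sum_k c_k y_k, bilinearity moves each correction x_0 ⊗ c_k y_k into
    the k-th term, whose first factor becomes x_k + c_k x_0; the number of terms
    does not change. Vectors y_k = 0 are allowed, which is why the y_k are
    orthogonal and not orthonormal. *)
Lemma orthogonal_tensor_sum m (x : 'I_m -> K1) (y : 'I_m -> K2) :
  exists (x' : 'I_m -> K1) (y' : 'I_m -> K2),
    \sum_i tens (x i) (y i) = \sum_i tens (x' i) (y' i) /\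
    forall i j, i != j -> dot2 (y' i) (y' j) = 0.
Proof.
elim: m x y => [|m IH] x y; first by exists x, y; split=> // -[].
have [x1 [y1 [E o1]]] := IH (x \o lift ord0) (y \o lift ord0).
pose c k := dot2 (y ord0) (y1 k) / dot2 (y1 k) (y1 k).
pose y0 := y ord0 - \sum_k c k *: y1 k.
have o0 j : dot2 y0 (y1 j) = 0.
  rewrite linearBl /= linear_sumlz /= (bigD1 j)//= big1 => [|k kj]; last first.
    by rewrite linearZl_LR /= o1// mulr0.
  rewrite addr0 linearZl_LR /= /c.
  have [->|yj] := eqVneq (y1 j) 0; first by rewrite !linear0r subr0.
  by rewrite divfK ?dnorm_eq0// subrr.
pose x' i := if unlift ord0 i is Some k then x1 k + c k *: x ord0 else x ord0.
pose y' i := if unlift ord0 i is Some k then y1 k else y0.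
exists x', y'; split.
  have tailE : \sum_i tens (x' (lift ord0 i)) (y' (lift ord0 i)) =
      \sum_i tens (x (lift ord0 i)) (y (lift ord0 i)) +
      tens (x ord0) (\sum_k c k *: y1 k).
    rewrite [X in X + _]E linear_sumr -big_split; apply: eq_bigr => k _.
    by rewrite /x' /y' liftK linearDl linearZl_LR linearZr_LR.
  rewrite !big_ord_recl tailE /x' /y' unlift_none addrCA -linearDr subrK.
  by rewrite addrC.
move=> i j ij; rewrite /y'; case: unliftP ij => [i' ->|->]; case: unliftP => [j' ->|->].
- by rewrite (inj_eq lift_inj) => /o1.
- by move=> _; rewrite dot_conj o0 rmorph0.
- by [].
- by rewrite eqxx.
Qed.

Context d1 d2 (X1 : measurableType d1) (X2 : measurableType d2).
Context (mu1 : {sigma_finite_measure set X1 -> \bar R}).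
Context (mu2 : {sigma_finite_measure set X2 -> \bar R}).

(** On a finite sum of elementary tensors the constants multiply by iterated
    integration, once the second factors are orthogonal; without orthogonality
    the cross terms could not be bounded by the norm of the sum. The general case
    is by density. *)
Lemma bessel_tensor (B1 B2 : R) (Phi1 : X1 -> K1) (Phi2 : X2 -> K2) :
  0 <= B1 -> 0 <= B2 ->
  bessel dot1 mu1 setT B1 Phi1 -> bessel dot2 mu2 setT B2 Phi2 ->
  bessel dotT (mu1 \x mu2)%E setT (B1 * B2)
    (fun x : X1 * X2 => tens (Phi1 x.1) (Phi2 x.2)).
Proof.
move=> B10 B20 b1 b2; apply: bessel_dense (tensor_dense hT) _.
move=> _ [m [x0 [y0 ->]]]; have [x [y [-> oy]]] := orthogonal_tensor_sum x0 y0.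
have uE (z : X1 * X2) : dotT (\sum_i tens (x i) (y i)) (tens (Phi1 z.1) (Phi2 z.2)) =
    \sum_i dot1 (x i) (Phi1 z.1) * dot2 (y i) (Phi2 z.2).
  by rewrite linear_sumlz; apply: eq_bigr => i _ /=; rewrite (tensor_dot hT).
have m1 i : cmeasurable (fun s => dot1 (x i) (Phi1 s)) by have [] := b1 (x i) I.
have m2 i : cmeasurable (fun s => dot2 (y i) (Phi2 s)) by have [] := b2 (y i) I.
pose u (z : X1 * X2) := \sum_i dot1 (x i) (Phi1 z.1) * dot2 (y i) (Phi2 z.2).
have -> : (fun z => dotT (\sum_i tens (x i) (y i)) (tens (Phi1 z.1) (Phi2 z.2))) = u.
  exact/funext.
have mU : cmeasurable u.
  by apply: cmeasurable_sum => i; exact: cmeasurable_tensor (m1 i) (m2 i).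
have u0 z : (0 <= (sqmod (u z))%:E)%E by rewrite lee_fin sqmod_ge0.
split=> //; rewrite /sq_integral.
rewrite (fubini_tonelli1 (fun z => (sqmod (u z))%:E))//; last exact: measurable_sqmodE.
(* For fixed s, the integral over X2 is the one that the Bessel bound of Phi2
   controls for the vector [ys]. *)
have inner s : (fubini_F mu2 (fun z => (sqmod (u z))%:E) s <=
    \sum_i (B2 * hnorm dot2 (y i) ^+ 2)%:E * (sqmod (dot1 (x i) (Phi1 s)))%:E)%E.
  pose ys := \sum_i dot1 (x i) (Phi1 s) *: y i.
  have -> : fubini_F mu2 (fun z => (sqmod (u z))%:E) s =
      sq_integral mu2 (fun r => dot2 ys (Phi2 r)).
    apply: eq_integral => r _; congr (sqmod _)%:E.
    by rewrite linear_sumlz; apply: eq_bigr => i _ /=; rewrite linearZl_LR.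
  have [_ ysB] := b2 ys I; apply: (le_trans ysB).
  rewrite hnorm_sum_orthogonal; last first.
    by move=> i j ij; rewrite linearZl_LR linearZr_LR /= oy// !mulr0.
  under [X in (_ <= X)%E]eq_bigr do rewrite -EFinM.
  rewrite sumEFin lee_fin mulr_sumr; apply: ler_sum => i _.
  by rewrite hnorm_sqrZ mulrA mulrAC.
apply: (@le_trans _ _ (\int[mu1]_s (\sum_i (B2 * hnorm dot2 (y i) ^+ 2)%:E *
    (sqmod (dot1 (x i) (Phi1 s)))%:E))%E).
  apply: ge0_le_integral => //.
  - by move=> s _; apply: integral_ge0.
  - apply: (measurable_fun_fubini_tonelli_F (fun z => (sqmod (u z))%:E)) => //.
    exact: measurable_sqmodE.
  - by apply: emeasurable_sum => i; apply: measurable_funeM; exact: measurable_sqmodE.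
have c0 i : 0 <= B2 * hnorm dot2 (y i) ^+ 2 by rewrite mulr_ge0 ?sqr_ge0.
rewrite ge0_integral_sum//; last 2 first.
- by move=> i; apply: measurable_funeM; exact: measurable_sqmodE.
- by move=> i s _; rewrite mule_ge0 ?lee_fin ?sqmod_ge0.
rewrite hnorm_sum_orthogonal; last first.
  by move=> i j ij; rewrite (tensor_dot hT) oy// mulr0.
rewrite mulr_sumr -sumEFin; apply: lee_sum => i _.
rewrite ge0_integralZl ?lee_fin//; last 2 first.
- exact: measurable_sqmodE.
- by move=> s _; rewrite lee_fin sqmod_ge0.
have [_ xB] := b1 (x i) I.
apply: (@le_trans _ _ ((B2 * hnorm dot2 (y i) ^+ 2)%:E *
    (B1 * hnorm dot1 (x i) ^+ 2)%:E)%E).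
  by apply: lee_wpmul2l => //; rewrite lee_fin.
rewrite -EFinM lee_fin !hnorm_sqr (tensor_dot hT) complexReM.
rewrite [dot1 _ _]dotxx [dot2 _ _]dotxx /= mul0r subr0 le_eqVlt; apply/orP; left.
by apply/eqP; ring.
Qed.

End TensorProduct.

(** * Frames of an n-inner product space seen in the completion *)

Section Frames.
Context (R : realType) (n : nat) (H : lmodType R[i]) (ip : nInnerProduct n H).
Context (a : n.-1.-tuple H) (K : lmodType R[i]) (dot : {dot K for Num.conj}).
Context (iota : {linear H -> K}) (hK : nip_completion ip a dot iota).
Context d (X : measurableType d) (mu : {measure set X -> \bar R}).

(** Frame inequalities for vectors of H are inequalities on the dense image of
    H in its completion. *)
Lemma nframe_bessel F : nframe ip a mu F ->
  exists2 B, 0 < B & bessel dot mu setT B (fun x => iota (F x)).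
Proof.
move=> [mF [A [B [A0 AB hF]]]]; exists B; first exact: lt_le_trans AB.
apply: bessel_dense (completion_dense hK) _ => _ [f _ <-].
under [X in cmeasurable X]eq_fun do rewrite (completion_dot hK).
under [X in sq_integral _ X]eq_fun do rewrite (completion_dot hK).
split; first exact: mF.
by have [_] := hF f; rewrite /nnorm /hnorm (completion_dot hK).
Qed.

(** Duality tests against vectors of H; testing against the whole completion is
    needed because the sums that are dense in the tensor product have factors
    there. *)
Lemma dual_nframe_completion G F f : nframe ip a mu F -> dual_nframe ip a mu G F ->
  forall y, has_cintegral mu (fun x => dot (iota f) (iota (F x)) * dot (iota (G x)) y)
    (dot (iota f) y).
Proof.
move=> hF [hG dual].
have [B B0 bG] := nframe_bessel hG.
have [C C0 bF] := nframe_bessel hF.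
have [mf fC] := bF (iota f) I.
apply: (has_cintegral_bessel (completion_dense hK) (ltW B0) _ bG mf fC).
  by rewrite mulr_ge0 ?sqr_ge0// ltW.
move=> _ [g _ <-]; rewrite (completion_dot hK).
by under eq_fun do rewrite !(completion_dot hK).
Qed.

End Frames.

(** Norm and frame integral are both multiplicative on elementary tensors, so
    the products of the bounds are bounds. *)
Lemma nframe_tensor (R : realType) (n : nat) (H1 H2 : lmodType R[i])
  (ip1 : nInnerProduct n H1) (ip2 : nInnerProduct n H2)
  (a : n.-1.-tuple H1) (b : n.-1.-tuple H2)
  (HF HG T : lmodType R[i])
  (dotF : {dot HF for Num.conj}) (iF : {linear H1 -> HF})
  (hF : nip_completion ip1 a dotF iF)
  (dotG : {dot HG for Num.conj}) (iG : {linear H2 -> HG})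
  (hG : nip_completion ip2 b dotG iG)
  (dotT : {dot T for Num.conj}) (tens : {bilinear HF -> HG -> T})
  (hT : hilbert_tensor dotF dotG dotT tens)
  (d1 d2 : measure_display) (X1 : measurableType d1) (X2 : measurableType d2)
  (mu1 : {sigma_finite_measure set X1 -> \bar R})
  (mu2 : {sigma_finite_measure set X2 -> \bar R})
  (F1 : X1 -> H1) (F2 : X2 -> H2) :
  nframe ip1 a mu1 F1 -> nframe ip2 b mu2 F2 ->
  tensor_frame iF iG dotT tens (mu1 \x mu2)%E
    (fun x : X1 * X2 => etensor iF iG tens (F1 x.1) (F2 x.2)).
Proof.
move=> [m1 [A1 [B1 [A10 AB1 fr1]]]] [m2 [A2 [B2 [A20 AB2 fr2]]]].
have E f g : (fun x : X1 * X2 =>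
    dotT (etensor iF iG tens f g) (etensor iF iG tens (F1 x.1) (F2 x.2))) =
    (fun x => ip1 f (F1 x.1) a * ip2 g (F2 x.2) b).
  by apply/funext => x; rewrite (etensor_dot hF hG hT).
split=> [f g|]; first by rewrite E; exact: cmeasurable_tensor (m1 f) (m2 g).
exists (A1 * A2), (B1 * B2).
have B10 := lt_le_trans A10 AB1; have B20 := lt_le_trans A20 AB2.
split; [exact: mulr_gt0..|] => f g.
have [l1 u1] := fr1 f; have [l2 u2] := fr2 g.
rewrite E (sq_integral_tensor mu1 mu2 (m1 f) (m2 g)) (etensor_norm hF hG hT) exprMn.
rewrite !(mulrACA _ _ (nnorm ip1 f a ^+ 2)) !EFinM.
have A1n : 0 <= A1 * nnorm ip1 f a ^+ 2 by rewrite mulr_ge0 ?sqr_ge0 ?ltW.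
have A2n : 0 <= A2 * nnorm ip2 g b ^+ 2 by rewrite mulr_ge0 ?sqr_ge0 ?ltW.
split; first by apply: lee_pmul => //; rewrite -EFinM lee_fin.
by apply: lee_pmul => //; apply: integral_ge0 => x _; rewrite lee_fin sqr_ge0.
Qed.

Theorem theorem4p9 (R : realType) (n : nat) (hn : (2 <= n)%N)
  (H1 H2 : lmodType R[i])
  (ip1 : nInnerProduct n H1) (ip2 : nInnerProduct n H2)
  (hH1 : nHilbert ip1) (hH2 : nHilbert ip2)
  (a : n.-1.-tuple H1) (b : n.-1.-tuple H2)
  (ha : lin_indep a) (hb : lin_indep b)
  (HF HG T : lmodType R[i])
  (dotF : {dot HF for Num.conj}) (iF : {linear H1 -> HF})
  (hF : nip_completion ip1 a dotF iF)
  (dotG : {dot HG for Num.conj}) (iG : {linear H2 -> HG})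
  (hG : nip_completion ip2 b dotG iG)
  (dotT : {dot T for Num.conj}) (tens : {bilinear HF -> HG -> T})
  (hT : hilbert_tensor dotF dotG dotT tens)
  (d1 d2 : measure_display) (X1 : measurableType d1) (X2 : measurableType d2)
  (mu1 : {sigma_finite_measure set X1 -> \bar R})
  (mu2 : {sigma_finite_measure set X2 -> \bar R})
  (F1 G1 : X1 -> H1) (F2 G2 : X2 -> H2)
  (hF1 : nframe ip1 a mu1 F1) (hF2 : nframe ip2 b mu2 F2)
  (hG1 : dual_nframe ip1 a mu1 G1 F1) (hG2 : dual_nframe ip2 b mu2 G2 F2) :
  dual_tensor_frame iF iG dotT tens (mu1 \x mu2)%E
    (fun x : X1 * X2 => etensor iF iG tens (G1 x.1) (G2 x.2))
    (fun x : X1 * X2 => etensor iF iG tens (F1 x.1) (F2 x.2)).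
Proof.
split; first exact: (nframe_tensor hF hG hT hF1 hF2).
  exact: (nframe_tensor hF hG hT hG1.1 hG2.1).
move=> f g.
have [B1 B10 bG1] := nframe_bessel hF hG1.1.
have [B2 B20 bG2] := nframe_bessel hG hG2.1.
have [C1 C10 bF1] := nframe_bessel hF hF1.
have [C2 C20 bF2] := nframe_bessel hG hF2.
have bG := bessel_tensor hT (ltW B10) (ltW B20) bG1 bG2.
have bF := bessel_tensor hT (ltW C10) (ltW C20) bF1 bF2.
have [mf fC] := bF (etensor iF iG tens f g) I.
apply: (has_cintegral_bessel (tensor_dense hT) _ _ bG mf fC).
- by rewrite mulr_ge0 ?ltW.
- by rewrite mulr_ge0 ?sqr_ge0// mulr_ge0 ?ltW.
move=> _ [m [x [y ->]]]; rewrite linear_sumr.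
have -> : (fun z : X1 * X2 =>
    dotT (etensor iF iG tens f g) (tens (iF (F1 z.1)) (iG (F2 z.2))) *
    dotT (tens (iF (G1 z.1)) (iG (G2 z.2))) (\sum_i tens (x i) (y i))) =
    (fun z => \sum_i (dotF (iF f) (iF (F1 z.1)) * dotF (iF (G1 z.1)) (x i)) *
                     (dotG (iG g) (iG (F2 z.2)) * dotG (iG (G2 z.2)) (y i))).
  apply/funext => z; rewrite linear_sumr mulr_sumr; apply: eq_bigr => i _.
  by rewrite /= !(tensor_dot hT) mulrACA.
apply: has_cintegral_sum => i; rewrite /= (tensor_dot hT).
apply: (has_cintegral_tensor
  (u := fun z => dotF (iF f) (iF (F1 z)) * dotF (iF (G1 z)) (x i))
  (v := fun z => dotG (iG g) (iG (F2 z)) * dotG (iG (G2 z)) (y i))).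
  exact: (dual_nframe_completion hF f hF1 hG1).
exact: (dual_nframe_completion hG g hF2 hG2).
Qed.
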